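(* Let $a<b$ be real numbers, let $n\ge 1$ be an integer, let $\mathbb{K}=\mathbb{R}$ or $\mathbb{K}=\mathbb{C}$, and let $U_n$ be an $(n+1)$-dimensional subspace of $C^n([a,b],\mathbb{K})$. Let $f_0,f_1\in U_n$ be such that $f_0>0$ on $[a,b]$ and $f_1/f_0$ is (real-valued and) strictly increasing on $[a,b]$. Suppose that $U_n$ has a non-negative Bernstein basis and that $$D_{f_0}U_n:=\left\{\frac{d}{dx}\left(\frac{f}{f_0}\right): f\in U_n\right\}$$ possesses a positive Bernstein basis. (i) If there exists a generalized Bernstein operator $B_n:C[a,b]\to U_n$ with non-decreasing nodes $t_{n,0}\le t_{n,1}\le\cdots\le t_{n,n}$, fixing $f_0$ and $f_1$ (that is, $B_nf_0=f_0$ and $B_nf_1=f_1$), then $$\left(\frac{f_1}{f_0}\right)'(x)>0\quad\text{for all }x\in(a,b).$$ (ii) If there exists a generalized Bernstein operator $B_n:C[a,b]\to U_n$ with strictly increasing nodes $t_{n,0}<t_{n,1}<\cdots<t_{n,n}$, fixing $f_0$ and $f_1$, then $$\left(\frac{f_1}{f_0}\right)'(x)>0\quad\text{for all }x\in[a,b].$$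
   Context: Bernstein basis: for an $(m+1)$-dimensional subspace $V_m$ of $C^m([a,b],\mathbb{K})$ (with $\mathbb{K}=\mathbb{R}$ or $\mathbb{C}$), a Bernstein basis of $V_m$ is a basis $\{v_{m,k}:k=0,\dots,m\}$ such that each $v_{m,k}$ has a zero of order (exactly) $k$ at $a$ and a zero of order (exactly) $m-k$ at $b$; additional zeros in $(a,b)$ are allowed. Here ''zero of order $j$ at $c$'' means that the derivatives of orders $0,\dots,j-1$ vanish at $c$ and the derivative of order $j$ does not. For $U_n$ this is used with $m=n$; for $D_{f_0}U_n$, which is an $n$-dimensional subspace of $C^{n-1}([a,b],\mathbb{K})$, it is used with $m=n-1$. A Bernstein basis is non-negative if $v_{m,k}\ge 0$ on $[a,b]$ for all $k=0,\dots,m$, and positive if $v_{m,k}>0$ on the open interval $(a,b)$ for all $k=0,\dots,m$. Derivatives at the endpoints $a,b$ are one-sided. Generalized Bernstein operator: given a non-negative Bernstein basis $\{p_{n,k}\}_{k=0}^n$ of $U_n$, a generalized Bernstein operator is an operator $B_n:C[a,b]\to U_n$ of the form $$B_n(f)=\sum_{k=0}^n f(t_{n,k})\,\alpha_{n,k}\,p_{n,k},$$ where the nodes $t_{n,0},\dots,t_{n,n}$ belong to $[a,b]$ and the weights $\alpha_{n,0},\dots,\alpha_{n,n}$ are positive real numbers. In general no ordering of the nodes is required. Here $C[a,b]$ denotes the space of continuous $\mathbb{K}$-valued functions on $[a,b]$. *)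

(* Defs.v *)
From Stdlib Require Import Reals.
From Coquelicot Require Import Coquelicot.

Open Scope R_scope.

(** The scalar field K, either R or C; both are normed spaces over R, which is
    what differentiating functions [R -> K] requires. *)
Inductive scalars : Set := real_scalars | complex_scalars.

Definition scalar_space (K : scalars) : NormedModule R_AbsRing :=
  match K with
  | real_scalars => R_NormedModule
  | complex_scalars => C_R_NormedModule
  end.

Coercion scalar_space : scalars >-> NormedModule.

Definition Kmult {K : scalars} : K -> K -> K :=
  match K return scalar_space K -> scalar_space K -> scalar_space K with
  | real_scalars => Rmult
  | complex_scalars => Cmult
  end.

Definition Kdiv {K : scalars} : K -> K -> K :=
  match K return scalar_space K -> scalar_space K -> scalar_space K with
  | real_scalars => Rdiv
  | complex_scalars => Cdiv
  end.

Definition RtoK {K : scalars} : R -> K :=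
  match K return R -> scalar_space K with
  | real_scalars => fun r => r
  | complex_scalars => RtoC
  end.

(** An inequality between elements of K includes the assertion that both sides
    are real. *)
Definition Kle {K : scalars} (z w : K) : Prop :=
  exists r s : R, z = RtoK r /\ w = RtoK s /\ r <= s.

Definition Klt {K : scalars} (z w : K) : Prop :=
  exists r s : R, z = RtoK r /\ w = RtoK s /\ r < s.

Definition Icc (a b x : R) : Prop := a <= x <= b.

(** Functions [a,b] -> K are represented by functions R -> K of which only the
    values on [a,b] matter; equality of functions is [eq_on a b]. *)
Definition eq_on {K : scalars} (a b : R) (f g : R -> K) : Prop :=
  forall x, Icc a b x -> f x = g x.

(** The limit is taken within [a,b], so derivatives at a and b are one-sided. *)
Definition is_derive_on {K : scalars} (a b : R) (f : R -> K) (x : R) (l : K) : Prop :=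
  filterdiff f (within (Icc a b) (locally x)) (fun h : R => scal h l).

Fixpoint is_nth_derive_on {K : scalars} (a b : R) (j : nat) (f g : R -> K) : Prop :=
  match j with
  | O => eq_on a b f g
  | S i => exists h : R -> K, is_nth_derive_on a b i f h /\
             forall x, Icc a b x -> is_derive_on a b h x (g x)
  end.

Definition class_C {K : scalars} (a b : R) (m : nat) (f : R -> K) : Prop :=
  exists g : R -> K, is_nth_derive_on a b m f g /\ continuous_on (Icc a b) g.

Definition zero_of_order {K : scalars} (a b : R) (f : R -> K) (j : nat) (c : R) : Prop :=
  (forall i, (i < j)%nat -> exists g, is_nth_derive_on a b i f g /\ g c = zero) /\
  (exists g, is_nth_derive_on a b j f g /\ g c <> zero).

(** The first clause says that membership only depends on the restriction
    to [a,b]. *)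
Definition is_subspace {K : scalars} (a b : R) (V : (R -> K) -> Prop) : Prop :=
  (forall f g, eq_on a b f g -> V f -> V g) /\
  V (fun _ => zero) /\
  (forall f g, V f -> V g -> V (fun x => plus (f x) (g x))) /\
  (forall (c : K) f, V f -> V (fun x => Kmult c (f x))).

(** [v 0, ..., v m] is a basis of V; note that [sum_n u m] is
    [u 0 + ... + u m]. *)
Definition is_basis {K : scalars} (a b : R) (V : (R -> K) -> Prop)
    (m : nat) (v : nat -> R -> K) : Prop :=
  (forall k, (k <= m)%nat -> V (v k)) /\
  (forall c : nat -> K,
     eq_on a b (fun x => sum_n (fun k => Kmult (c k) (v k x)) m) (fun _ => zero) ->
     forall k, (k <= m)%nat -> c k = zero) /\
  (forall f, V f -> exists c : nat -> K,
     eq_on a b f (fun x => sum_n (fun k => Kmult (c k) (v k x)) m)).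

(** V is an (m+1)-dimensional subspace of C^m([a,b],K). *)
Definition is_Cm_subspace {K : scalars} (a b : R) (m : nat)
    (V : (R -> K) -> Prop) : Prop :=
  is_subspace a b V /\
  (forall f, V f -> class_C a b m f) /\
  (exists v, is_basis a b V m v).

Definition is_Bernstein_basis {K : scalars} (a b : R) (V : (R -> K) -> Prop)
    (m : nat) (v : nat -> R -> K) : Prop :=
  is_basis a b V m v /\
  forall k, (k <= m)%nat ->
    zero_of_order a b (v k) k a /\ zero_of_order a b (v k) (m - k) b.

Definition nonneg_Bernstein_basis {K : scalars} (a b : R) (V : (R -> K) -> Prop)
    (m : nat) (v : nat -> R -> K) : Prop :=
  is_Bernstein_basis a b V m v /\
  forall k x, (k <= m)%nat -> Icc a b x -> Kle zero (v k x).

Definition pos_Bernstein_basis {K : scalars} (a b : R) (V : (R -> K) -> Prop)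
    (m : nat) (v : nat -> R -> K) : Prop :=
  is_Bernstein_basis a b V m v /\
  forall k x, (k <= m)%nat -> a < x < b -> Klt zero (v k x).

Definition quot {K : scalars} (f g : R -> K) (x : R) : K := Kdiv (f x) (g x).

Definition D_space {K : scalars} (a b : R) (f0 : R -> K) (U : (R -> K) -> Prop)
    (g : R -> K) : Prop :=
  exists f, U f /\ forall x, Icc a b x -> is_derive_on a b (quot f f0) x (g x).

(** The values of [B] matter only at functions continuous on [a,b]; the basis
    [p] and the weights [alpha] are part of the operator. *)
Definition is_gen_Bernstein_op {K : scalars} (a b : R) (n : nat)
    (U : (R -> K) -> Prop) (t : nat -> R) (B : (R -> K) -> (R -> K)) : Prop :=
  exists (p : nat -> R -> K) (alpha : nat -> R),
    nonneg_Bernstein_basis a b U n p /\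
    (forall k, (k <= n)%nat -> Icc a b (t k)) /\
    (forall k, (k <= n)%nat -> 0 < alpha k) /\
    (forall f, continuous_on (Icc a b) f ->
       eq_on a b (B f)
         (fun x => sum_n (fun k => Kmult (Kmult (f (t k)) (RtoK (alpha k))) (p k x)) n)).

(* Main.v *)
(** Write [phi = f1 / f0] and let [w k] be the basis function [p k] scaled so that
    [B f0 = f0] reads [w 0 + ... + w n = 1]; then [B f1 = f1] reads
    [phi = phi (t 0) w 0 + ... + phi (t n) w n].  By Abel summation
    [phi' = - sum_j (phi (t (j+1)) - phi (t j)) S_j'], where [S_j = w 0 + ... + w j].
    The function [S_j'] lies in [D_space], has a zero of order at least [j] at [a]
    (as [S_j = 1 - (w (j+1) + ... + w n)]) and one of order at least [n-1-j] at [b], so it is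
    a multiple of the Bernstein basis function [q j]; as [S_j] decreases from 1 to 0, the
    factor is negative.  Hence [phi'] is a combination of the [q j] with coefficients of the
    sign of [phi (t (j+1)) - phi (t j)].

    Orders of vanishing are handled through leading terms [f x ~ L (x - c)^j], which avoids
    higher derivatives of quotients. *)
Require Import Defs.
From Stdlib Require Import Reals Arith Lra Lia.
From Coquelicot Require Import Coquelicot.

(** * Finite choice and finite sums *)

Lemma finite_choice {A : Type} (x0 : A) (P : nat -> A -> Prop) (N : nat) :
  (forall j, (j <= N)%nat -> exists x, P j x) ->
  exists f : nat -> A, forall j, (j <= N)%nat -> P j (f j).
Proof.
  induction N as [| N IH]; intros H.
  - destruct (H 0%nat (le_n 0)) as [x Hx]. exists (fun _ => x).
    intros j Hj. now replace j with 0%nat by lia.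
  - destruct IH as [f Hf]; [intros j Hj; apply H; lia |].
    destruct (H (S N) (le_n _)) as [x Hx].
    exists (fun j => if Nat.eq_dec j (S N) then x else f j).
    intros j Hj. destruct (Nat.eq_dec j (S N)) as [-> | Hne]; [assumption |].
    apply Hf. lia.
Qed.

Lemma sum_n_single {G : AbelianMonoid} (u : nat -> G) (N j : nat) : (j <= N)%nat ->
  (forall i, (i <= N)%nat -> i <> j -> u i = zero) -> sum_n u N = u j.
Proof.
  intros Hj H.
  assert (Hz : forall m, (m < j)%nat -> sum_n u m = zero).
  { intros m Hm. induction m as [| m IH].
    - rewrite sum_O. apply H; lia.
    - rewrite sum_Sn, IH, H by lia. apply plus_zero_l. }
  induction Hj as [| N Hj IH].
  - destruct j as [| j]; [apply sum_O |].
    rewrite sum_Sn, Hz by lia. apply plus_zero_l.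
  - rewrite sum_Sn, IH, (H (S N)); [apply plus_zero_r | lia | lia |].
    intros i Hi. apply H. lia.
Qed.

Lemma sum_n_Rext (u v : nat -> R) (N : nat) :
  (forall i, (i <= N)%nat -> u i = v i) -> sum_n u N = sum_n v N.
Proof. exact (sum_n_ext_loc u v N). Qed.

Lemma sum_n_Rmult_l (r : R) (u : nat -> R) (N : nat) :
  sum_n (fun k => r * u k) N = r * sum_n u N.
Proof. exact (sum_n_mult_l (K := R_Ring) r u N). Qed.

Lemma sum_n_nonneg (u : nat -> R) (N : nat) :
  (forall i, (i <= N)%nat -> 0 <= u i) -> 0 <= sum_n u N.
Proof.
  induction N as [| N IH]; intros H.
  - rewrite sum_O. apply H; lia.
  - rewrite sum_Sn. apply Rplus_le_le_0_compat; [apply IH; intros; apply H; lia | apply H; lia].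
Qed.

Lemma sum_n_pos (u : nat -> R) (N j : nat) : (j <= N)%nat -> 0 < u j ->
  (forall i, (i <= N)%nat -> 0 <= u i) -> 0 < sum_n u N.
Proof.
  intros Hj Huj. induction Hj as [| N Hj IH]; intros H.
  - destruct j as [| j]; [now rewrite sum_O |].
    rewrite sum_Sn. apply Rplus_le_lt_0_compat; [| assumption].
    apply sum_n_nonneg. intros; apply H; lia.
  - rewrite sum_Sn. apply Rplus_lt_le_0_compat; [apply IH; intros; apply H; lia | apply H; lia].
Qed.

(** The boundary term carries the full sum of [w]. In the application this sum is identically 1, so
    the term is constant and disappears on differentiation. *)
Lemma abel_summation (tau w : nat -> R) (N : nat) :
  sum_n (fun k => tau k * w k) (S N) =
  tau (S N) * sum_n w (S N) + sum_n (fun j => (tau j - tau (S j)) * sum_n w j) N.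
Proof.
  induction N as [| N IH].
  - rewrite !sum_Sn, !sum_O. unfold plus; simpl. ring.
  - rewrite sum_Sn, IH.
    rewrite (sum_Sn (fun j => (tau j - tau (S j)) * sum_n w j)), (sum_Sn w (S N)).
    unfold plus; simpl. ring.
Qed.

(** * Leading terms of real functions on [a,b] *)

Section Interval.

Variables a b : R.
Hypothesis hab : a < b.

Notation near c := (within (Icc a b) (locally c)).

(* [f x = L (x - c)^j + o((x - c)^j)] on [a,b]; for [j = 0] only the value at [c] is
   prescribed, so that no continuity is required. *)
Definition leading_term (f : R -> R) (c : R) (j : nat) (L : R) : Prop :=
  f c = L * 0 ^ j /\
  ((0 < j)%nat -> forall eps, 0 < eps ->
     near c (fun x => Rabs (f x - L * (x - c) ^ j) <= eps * Rabs (x - c) ^ j)).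

(** Differentiability within [a,b], one-sided at the endpoints. Phrased as a leading term of order 1
    of the increment, it inherits its calculus rules from those for leading terms. *)
Definition real_derive (f : R -> R) (c l : R) : Prop :=
  leading_term (fun x => f x - f c) c 1 l.

Lemma near_Rabs (c d : R) : 0 < d -> near c (fun x => Rabs (x - c) < d).
Proof.
  intros Hd. exists (mkposreal d Hd). intros y Hy _. exact Hy.
Qed.

Lemma near_Icc (c : R) : near c (Icc a b).
Proof.
  exists (mkposreal 1 Rlt_0_1). intros y _ Hy. exact Hy.
Qed.

(** As a < b, no point of [a,b] is isolated: below [b] there is room on the right, and at [b] there
    is room on the left. Uniqueness of leading coefficients and of derivatives rests on this. *)
Lemma near_punctured (c : R) (P : R -> Prop) :
  Icc a b c -> near c P -> exists x, Icc a b x /\ x <> c /\ P x.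
Proof.
  intros [Hac Hcb] [d Hd]. pose proof (cond_pos d) as Hd0.
  destruct (Rlt_dec c b) as [Hlt | Hge].
  - exists (c + Rmin (d / 2) (b - c)).
    pose proof (Rmin_l (d / 2) (b - c)). pose proof (Rmin_r (d / 2) (b - c)).
    assert (0 < Rmin (d / 2) (b - c)) by (apply Rmin_glb_lt; lra).
    split; [split; lra | split; [lra | apply Hd]].
    + change (Rabs (c + Rmin (d / 2) (b - c) - c) < d).
      rewrite Rabs_right; lra.
    + split; lra.
  - exists (c - Rmin (d / 2) (c - a)).
    pose proof (Rmin_l (d / 2) (c - a)). pose proof (Rmin_r (d / 2) (c - a)).
    assert (0 < Rmin (d / 2) (c - a)) by (apply Rmin_glb_lt; lra).
    split; [split; lra | split; [lra | apply Hd]].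
    + change (Rabs (c - Rmin (d / 2) (c - a) - c) < d).
      rewrite Rabs_left; lra.
    + split; lra.
Qed.

Lemma leading_term_ext (f g : R -> R) (c : R) (j : nat) (L : R) :
  Icc a b c -> (forall x, Icc a b x -> f x = g x) ->
  leading_term f c j L -> leading_term g c j L.
Proof.
  intros Hc Hfg [H0 H]. split.
  - rewrite <- Hfg; assumption.
  - intros Hj eps Heps. specialize (H Hj eps Heps).
    generalize (filter_and _ _ (near_Icc c) H). apply filter_imp.
    intros x [Hx Hfx]. rewrite <- Hfg; assumption.
Qed.

Lemma leading_term_zero (c : R) (j : nat) : leading_term (fun _ => 0) c j 0.
Proof.
  split.
  - ring.
  - intros _ eps Heps. apply filter_forall. intros x.
    replace (0 - 0 * (x - c) ^ j) with 0 by ring. rewrite Rabs_R0.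
    apply Rmult_le_pos; [lra | apply pow_le, Rabs_pos].
Qed.

Lemma leading_term_plus (f g : R -> R) (c : R) (j : nat) (L M : R) :
  leading_term f c j L -> leading_term g c j M ->
  leading_term (fun x => f x + g x) c j (L + M).
Proof.
  intros [Hf0 Hf] [Hg0 Hg]. split.
  - rewrite Hf0, Hg0. ring.
  - intros Hj eps Heps. assert (H2 : 0 < eps / 2) by lra.
    generalize (filter_and _ _ (Hf Hj _ H2) (Hg Hj _ H2)). apply filter_imp.
    intros x [Hfx Hgx].
    replace (f x + g x - (L + M) * (x - c) ^ j)
      with ((f x - L * (x - c) ^ j) + (g x - M * (x - c) ^ j)) by ring.
    eapply Rle_trans; [apply Rabs_triang | lra].
Qed.

(** To leading order a continuous factor acts through its value at [c]. With g = 1/f0 this shows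
    that division by [f0] preserves orders of vanishing. *)
Lemma leading_term_mult (f g : R -> R) (c : R) (j : nat) (L : R) :
  leading_term f c j L -> filterlim g (near c) (locally (g c)) ->
  leading_term (fun x => f x * g x) c j (L * g c).
Proof.
  intros [Hf0 Hf] Hg. split.
  - rewrite Hf0. ring.
  - intros Hj eps Heps.
    (* [A] bounds |g| near [c], and [B] is a positive bound for |L|. Half of [eps] goes to (f - L u)
       g and half to L (g - g c) u, where u = (x - c)^j. *)
    set (A := Rabs (g c) + 1). set (B := Rabs L + 1).
    assert (HA : 0 < A) by (unfold A; pose proof (Rabs_pos (g c)); lra).
    assert (HB : 0 < B) by (unfold B; pose proof (Rabs_pos L); lra).
    set (d := Rmin 1 (eps / 2 / B)).
    assert (Hd : 0 < d).
    { apply Rmin_glb_lt; [lra |]. apply Rdiv_lt_0_compat; lra. }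
    assert (Hgd : near c (fun x => Rabs (g x - g c) < d)).
    { apply (Hg (fun y => Rabs (y - g c) < d)).
      exists (mkposreal d Hd). intros y Hy. exact Hy. }
    assert (HeA : 0 < eps / 2 / A) by (apply Rdiv_lt_0_compat; lra).
    generalize (filter_and _ _ (Hf Hj _ HeA) Hgd). apply filter_imp.
    intros x [Hfx Hgx].
    assert (Hd1 : d <= 1) by apply Rmin_l.
    assert (Hd2 : d <= eps / 2 / B) by apply Rmin_r.
    set (u := (x - c) ^ j) in *.
    assert (Hu : Rabs (x - c) ^ j = Rabs u) by (unfold u; now rewrite RPow_abs).
    rewrite Hu in *. pose proof (Rabs_pos u) as Hu0.
    replace (f x * g x - L * g c * u)
      with ((f x - L * u) * g x + L * (g x - g c) * u) by ring.
    eapply Rle_trans; [apply Rabs_triang |].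
    rewrite !Rabs_mult.
    assert (HgA : Rabs (g x) <= A).
    { replace (g x) with (g c + (g x - g c)) by ring.
      eapply Rle_trans; [apply Rabs_triang | unfold A; lra]. }
    assert (H1 : Rabs (f x - L * u) * Rabs (g x) <= eps / 2 * Rabs u).
    { replace (eps / 2 * Rabs u) with ((eps / 2 / A * Rabs u) * A) by (field; lra).
      apply Rmult_le_compat; try apply Rabs_pos; assumption. }
    assert (H2 : Rabs L * Rabs (g x - g c) <= eps / 2).
    { replace (eps / 2) with (B * (eps / 2 / B)) by (field; lra).
      apply Rmult_le_compat; try apply Rabs_pos; unfold B in *; lra. }
    apply (Rmult_le_compat_r _ _ _ Hu0) in H2. lra.
Qed.

Lemma leading_term_scal (f : R -> R) (c : R) (j : nat) (r L : R) :
  leading_term f c j L -> leading_term (fun x => r * f x) c j (r * L).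
Proof.
  intros Hf. rewrite Rmult_comm.
  apply (leading_term_mult f (fun _ => r)) in Hf.
  - destruct Hf as [H0 H]. split.
    + rewrite <- H0. ring.
    + intros Hj eps Heps. generalize (H Hj eps Heps). apply filter_imp.
      intros x. now rewrite (Rmult_comm r).
  - apply filterlim_const.
Qed.

Lemma leading_term_sum (f : nat -> R -> R) (c : R) (j : nat) (L : nat -> R) (m n : nat) :
  (forall i, (m <= i <= n)%nat -> leading_term (f i) c j (L i)) ->
  leading_term (fun x => sum_n_m (fun i => f i x) m n) c j (sum_n_m L m n).
Proof.
  intros H.
  destruct (le_lt_dec m n) as [Hmn | Hmn].
  - induction Hmn as [| n Hmn IH].
    + rewrite sum_n_n. destruct (H m) as [H0 H1]; [lia |]. split.
      * rewrite sum_n_n. exact H0.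
      * intros Hj eps Heps. generalize (H1 Hj eps Heps). apply filter_imp.
        intros x. now rewrite sum_n_n.
    + rewrite sum_n_Sm by lia.
      destruct (leading_term_plus _ _ c j _ _ (IH (fun i Hi => H i ltac:(lia)))
                  (H (S n) ltac:(lia))) as [H0 H1].
      split.
      * rewrite sum_n_Sm by lia. exact H0.
      * intros Hj eps Heps. generalize (H1 Hj eps Heps). apply filter_imp.
        intros x. rewrite sum_n_Sm by lia. exact (fun h => h).
  - rewrite sum_n_m_zero by assumption.
    destruct (leading_term_zero c j) as [H0 H1]. split.
    + rewrite sum_n_m_zero by assumption. exact H0.
    + intros Hj eps Heps. generalize (H1 Hj eps Heps). apply filter_imp.
      intros x. now rewrite sum_n_m_zero by assumption.
Qed.

Lemma leading_term_weaken (f : R -> R) (c : R) (m k : nat) (L : R) :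
  (m < k)%nat -> leading_term f c k L -> leading_term f c m 0.
Proof.
  intros Hmk [H0 H]. split.
  - rewrite H0, pow_i by lia. ring.
  - intros _ eps Heps.
    (* Using the hypothesis with tolerance 1 gives |f x| <= B |x - c|^k. Of the k - m surplus
       factors |x - c|, one is at most eps / B and the others are at most 1. *)
    set (B := Rabs L + 1). assert (HB : 0 < B) by (unfold B; pose proof (Rabs_pos L); lra).
    assert (Hd : 0 < Rmin 1 (eps / B)).
    { apply Rmin_glb_lt; [lra |]. apply Rdiv_lt_0_compat; lra. }
    assert (Hlt : (0 < k)%nat) by lia.
    generalize (filter_and _ _ (H Hlt 1 Rlt_0_1) (near_Rabs c _ Hd)).
    apply filter_imp. intros x [Hx Hxc].
    pose proof (Rmin_l 1 (eps / B)). pose proof (Rmin_r 1 (eps / B)).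
    replace (f x - 0 * (x - c) ^ m) with ((f x - L * (x - c) ^ k) + L * (x - c) ^ k) by ring.
    eapply Rle_trans; [apply Rabs_triang |].
    rewrite Rabs_mult, <- (RPow_abs (x - c) k).
    set (y := Rabs (x - c)) in *. assert (Hy : 0 <= y) by apply Rabs_pos.
    set (r := (k - m - 1)%nat).
    assert (Hk : y ^ k = y ^ m * (y * y ^ r)).
    { replace k with (m + S r)%nat by (unfold r; lia). apply pow_add. }
    rewrite Hk in *.
    assert (Hr1 : 0 <= y ^ r <= 1).
    { split; [now apply pow_le |]. rewrite <- (pow1 r). apply pow_incr. lra. }
    assert (Hm : 0 <= y ^ m) by now apply pow_le.
    assert (HyB : B * y <= eps).
    { replace eps with (B * (eps / B)) by (field; lra). apply Rmult_le_compat_l; lra. }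
    assert (Hyr : y * y ^ r <= y) by nra.
    apply Rle_trans with (B * (y * y ^ r) * y ^ m).
    + unfold B. lra.
    + apply Rmult_le_compat_r; [assumption |].
      apply Rle_trans with (B * y); [apply Rmult_le_compat_l; lra | assumption].
Qed.

Lemma leading_term_unique (f : R -> R) (c : R) (j : nat) (L M : R) :
  Icc a b c -> leading_term f c j L -> leading_term f c j M -> L = M.
Proof.
  intros Hc [Hf0 Hf] [Hg0 Hg].
  destruct (Nat.eq_dec j 0) as [-> | Hj].
  - simpl in *. lra.
  - destruct (Req_dec L M) as [| Hne]; [assumption | exfalso].
    (* With a quarter of |L - M| as tolerance for both terms, a nearby point other than [c] gives |L
       - M| |u| <= |L - M| / 2 |u| with u nonzero. *)
    assert (He : 0 < Rabs (L - M) / 4).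
    { apply Rdiv_lt_0_compat; [apply Rabs_pos_lt; lra | lra]. }
    assert (Hlt : (0 < j)%nat) by lia.
    destruct (near_punctured c _ Hc
      (filter_and _ _ (Hf Hlt _ He) (Hg Hlt _ He))) as [x [_ [Hxc [H1 H2]]]].
    set (u := (x - c) ^ j) in *.
    assert (Hu : Rabs (x - c) ^ j = Rabs u) by (unfold u; now rewrite RPow_abs).
    rewrite Hu in *.
    assert (Hu0 : 0 < Rabs u) by (rewrite <- Hu; apply pow_lt, Rabs_pos_lt; lra).
    assert (H3 : Rabs (L - M) * Rabs u <= Rabs (L - M) / 2 * Rabs u).
    { rewrite <- Rabs_mult.
      replace ((L - M) * u) with ((f x - M * u) + - (f x - L * u)) by ring.
      eapply Rle_trans; [apply Rabs_triang |]. rewrite Rabs_Ropp. lra. }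
    apply Rmult_le_reg_r in H3; lra.
Qed.

Lemma leading_term_vanish (f : R -> R) (c : R) (j : nat) (L : R) :
  (0 < j)%nat -> leading_term f c j L -> f c = 0.
Proof.
  intros Hj [H _]. rewrite H, pow_i by assumption. ring.
Qed.

(** * Calculus rules for derivatives within [a,b] *)

Lemma real_derive_ext (f g : R -> R) (c l : R) :
  Icc a b c -> (forall x, Icc a b x -> f x = g x) ->
  real_derive f c l -> real_derive g c l.
Proof.
  intros Hc Hfg. apply leading_term_ext; [assumption |].
  intros x Hx. now rewrite !Hfg.
Qed.

Lemma real_derive_plus (f g : R -> R) (c l m : R) : Icc a b c ->
  real_derive f c l -> real_derive g c m ->
  real_derive (fun x => f x + g x) c (l + m).
Proof.
  intros Hc Hf Hg. eapply leading_term_ext; [assumption | | exact (leading_term_plus _ _ _ _ _ _ Hf Hg)].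
  intros x _. simpl. ring.
Qed.

Lemma real_derive_scal (f : R -> R) (c r l : R) : Icc a b c ->
  real_derive f c l -> real_derive (fun x => r * f x) c (r * l).
Proof.
  intros Hc Hf. eapply leading_term_ext; [assumption | | exact (leading_term_scal _ _ _ r _ Hf)].
  intros x _. simpl. ring.
Qed.

Lemma real_derive_const (r c : R) : Icc a b c -> real_derive (fun _ => r) c 0.
Proof.
  intros Hc. eapply leading_term_ext; [assumption | | exact (leading_term_zero c 1)].
  intros x _. simpl. ring.
Qed.

Lemma real_derive_unique (f : R -> R) (c l m : R) : Icc a b c ->
  real_derive f c l -> real_derive f c m -> l = m.
Proof. apply leading_term_unique. Qed.

Lemma real_derive_continuous (f : R -> R) (c l : R) :
  real_derive f c l -> filterlim f (near c) (locally (f c)).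
Proof.
  intros H P [d Hd]. pose proof (cond_pos d) as Hd0.
  destruct H as [_ H].
  set (B := Rabs l + 1). assert (HB : 0 < B) by (unfold B; pose proof (Rabs_pos l); lra).
  assert (HdB : 0 < d / B) by (apply Rdiv_lt_0_compat; lra).
  assert (Hlt : (0 < 1)%nat) by lia.
  generalize (filter_and _ _ (H Hlt 1 Rlt_0_1) (near_Rabs c _ HdB)).
  unfold filtermap. apply filter_imp. intros x [Hx Hxc]. apply Hd. change (Rabs (f x - f c) < d).
  rewrite !pow_1 in Hx.
  replace (f x - f c) with ((f x - f c - l * (x - c)) + l * (x - c)) by ring.
  eapply Rle_lt_trans; [apply Rabs_triang |]. rewrite Rabs_mult.
  apply Rle_lt_trans with (B * Rabs (x - c)); [unfold B; lra |].
  replace (pos d) with (B * (d / B)) by (field; lra).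
  now apply Rmult_lt_compat_l.
Qed.

Lemma filterlim_inv (g : R -> R) (c : R) : 0 < g c ->
  filterlim g (near c) (locally (g c)) ->
  filterlim (fun x => / g x) (near c) (locally (/ g c)).
Proof.
  intros Hg0 Hg. eapply filterlim_comp; [exact Hg |].
  apply (continuous_Rinv (g c)). lra.
Qed.

(** The increment of the quotient is (g c (f x - f c) - f c (g x - g c)) / (g c g x): a combination
    of the two increments, times the continuous factor 1/g. *)
Lemma real_derive_div (f g : R -> R) (c l m : R) :
  Icc a b c -> (forall x, Icc a b x -> 0 < g x) ->
  real_derive f c l -> real_derive g c m ->
  real_derive (fun x => f x / g x) c ((l * g c - f c * m) / (g c * g c)).
Proof.
  intros Hc Hpos Hf Hg.
  pose proof (Hpos c Hc) as Hgc.
  pose proof (leading_term_plus _ _ _ _ _ _ (leading_term_scal _ _ _ (g c) _ Hf)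
    (leading_term_scal _ _ _ (- f c) _ Hg)) as H.
  apply (leading_term_scal _ _ _ (/ g c)) in H.
  apply (leading_term_mult _ (fun x => / g x)) in H.
  2: { apply filterlim_inv; [assumption | eapply real_derive_continuous; exact Hg]. }
  replace ((l * g c - f c * m) / (g c * g c))
    with (/ g c * (g c * l + - f c * m) * / g c) by (field; lra).
  eapply leading_term_ext; [assumption | | exact H].
  intros x Hx. pose proof (Hpos x Hx). simpl. field. lra.
Qed.

(** * The mean value theorem and integration of leading terms *)

Definition clamp (x : R) : R := Rmax a (Rmin b x).

Lemma clamp_Icc (x : R) : Icc a b (clamp x).
Proof.
  unfold clamp, Rmax, Rmin. split; repeat destruct Rle_dec; lra.
Qed.

Lemma clamp_id (x : R) : Icc a b x -> clamp x = x.
Proof.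
  intros [H1 H2]. unfold clamp, Rmax, Rmin. repeat destruct Rle_dec; lra.
Qed.

Lemma clamp_lipschitz (x y : R) : Rabs (clamp y - clamp x) <= Rabs (y - x).
Proof.
  unfold clamp, Rmax, Rmin, Rabs.
  repeat destruct Rle_dec; repeat destruct Rcase_abs; lra.
Qed.

(* Stdlib's mean value theorem wants two-sided continuity, which [F o clamp] has. *)
Lemma real_mvt (F f : R -> R) (u v : R) :
  (forall x, Icc a b x -> real_derive F x (f x)) ->
  a <= u -> u < v -> v <= b ->
  exists y, u < y < v /\ F v - F u = f y * (v - u).
Proof.
  intros HF Hau Huv Hvb.
  assert (Hd : forall y, u < y < v -> derivable_pt_lim (fun x => F (clamp x)) y (f y)).
  { intros y Hy eps Heps.
    assert (HyI : Icc a b y) by (split; lra).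
    destruct (HF y HyI) as [_ H].
    assert (He2 : 0 < eps / 2) by lra.
    destruct (H ltac:(lia) _ He2) as [d Hd].
    assert (Hd' : 0 < Rmin d (Rmin (y - a) (b - y))).
    { apply Rmin_glb_lt; [apply cond_pos | apply Rmin_glb_lt; lra]. }
    exists (mkposreal _ Hd'). intros h Hh Hhd. simpl in Hhd.
    pose proof (Rmin_l d (Rmin (y - a) (b - y))). pose proof (Rmin_r d (Rmin (y - a) (b - y))).
    pose proof (Rmin_l (y - a) (b - y)). pose proof (Rmin_r (y - a) (b - y)).
    assert (HhI : Icc a b (y + h)).
    { apply Rabs_def2 in Hhd. split; lra. }
    rewrite (clamp_id y), (clamp_id (y + h)) by assumption.
    assert (Hb : Rabs (F (y + h) - F y - f y * (y + h - y) ^ 1) <= eps / 2 * Rabs (y + h - y) ^ 1).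
    { apply Hd; [| assumption]. change (Rabs (y + h - y) < d).
      replace (y + h - y) with h by ring. lra. }
    rewrite !pow_1 in Hb. replace (y + h - y) with h in Hb by ring.
    replace ((F (y + h) - F y) / h - f y) with ((F (y + h) - F y - f y * h) / h) by (field; assumption).
    unfold Rdiv. rewrite Rabs_mult, Rabs_inv.
    assert (Hah : 0 < Rabs h) by now apply Rabs_pos_lt.
    apply Rle_lt_trans with (eps / 2 * Rabs h * / Rabs h).
    - apply Rmult_le_compat_r; [| assumption]. left. now apply Rinv_0_lt_compat.
    - rewrite Rmult_assoc, Rinv_r by lra. lra. }
  assert (Hc : forall y, u <= y <= v -> continuity_pt (fun x => F (clamp x)) y).
  { intros y Hy. apply continuity_pt_filterlim.
    intros P HP.
    assert (HyI : Icc a b y) by (split; lra).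
    rewrite (clamp_id y HyI) in HP.
    destruct (real_derive_continuous F y _ (HF y HyI) P HP) as [d Hdd].
    exists d. intros x Hx. apply Hdd; [| apply clamp_Icc].
    change (Rabs (clamp x - y) < d). rewrite <- (clamp_id y HyI).
    eapply Rle_lt_trans; [apply clamp_lipschitz | exact Hx]. }
  assert (pr1 : forall y, u < y < v -> derivable_pt (fun x => F (clamp x)) y).
  { intros y Hy. exists (f y). now apply Hd. }
  destruct (MVT _ id u v pr1 (fun y _ => derivable_pt_id y) Huv Hc
    (fun y _ => derivable_continuous_pt _ _ (derivable_pt_id y))) as [y [Hy Heq]].
  exists y. split; [assumption |].
  rewrite derive_pt_id in Heq.
  rewrite (derive_pt_eq_0 _ _ (f y) (pr1 y Hy) (Hd y Hy)) in Heq.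
  unfold id in Heq. rewrite !clamp_id in Heq by (split; lra). lra.
Qed.

(** For j > 0, apply the mean value theorem to F - L/(j+1) (x - c)^(j+1). Between [c] and x its
    derivative f - L (y - c)^j is at most eps |y - c|^j, hence at most eps |x - c|^j. *)
Lemma leading_term_primitive (F f : R -> R) (c : R) (j : nat) (L : R) :
  Icc a b c -> (forall x, Icc a b x -> real_derive F x (f x)) -> F c = 0 ->
  leading_term f c j L -> leading_term F c (S j) (L / INR (S j)).
Proof.
  intros Hc HF HFc [Hf0 Hf].
  destruct (Nat.eq_dec j 0) as [-> | Hj].
  (* For order 0 the hypothesis only says f c = L, and the claim is the differentiability of [F] at
     [c]. *)
  - simpl in Hf0. replace (L / INR 1) with (f c) by (simpl; lra).
    eapply leading_term_ext; [assumption | | exact (HF c Hc)].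
    intros x _. simpl. rewrite HFc. ring.
  - split; [rewrite HFc, pow_i by lia; ring |].
    intros _ eps Heps. destruct (Hf ltac:(lia) _ Heps) as [d Hd].
    exists d. intros x Hx HxI. change (Rabs (x - c) < d) in Hx.
    change R in x.
    assert (HG : forall y, Icc a b y ->
      real_derive (fun y => F y + - (L / INR (S j)) * (y - c) ^ S j) y
        (f y + - (L / INR (S j)) * (INR (S j) * (y - c) ^ j))).
    { intros y Hy. apply real_derive_plus; [assumption | now apply HF |].
      apply real_derive_scal; [assumption |].
      split; [simpl; ring |]. intros _ e He.
      assert (Hp : derivable_pt_lim (fun y => (y - c) ^ S j) y (INR (S j) * (y - c) ^ j)).
      { apply is_derive_Reals. auto_derive; [trivial |].
        change (1 * (INR (S j) * (y - c) ^ j) = INR (S j) * (y - c) ^ j). ring. }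
      destruct (Hp e He) as [d' Hd']. exists d'. intros z Hz _. change R in z.
      change (Rabs (z - y) < d') in Hz.
      destruct (Req_dec z y) as [-> | Hzy].
      - rewrite !Rminus_diag, !pow_1, Rmult_0_r, Rminus_0_r, Rabs_R0. lra.
      - specialize (Hd' (z - y) ltac:(lra) Hz). rewrite !pow_1.
        replace (y + (z - y)) with z in Hd' by ring.
        replace ((z - c) ^ S j - (y - c) ^ S j - INR (S j) * (y - c) ^ j * (z - y))
          with ((((z - c) ^ S j - (y - c) ^ S j) / (z - y) - INR (S j) * (y - c) ^ j) * (z - y))
          by (field; lra).
        rewrite Rabs_mult. apply Rmult_le_compat_r; [apply Rabs_pos | lra]. }
    assert (Hkey : forall y, Icc a b y -> Rabs (y - c) <= Rabs (x - c) ->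
      Rabs (f y + - (L / INR (S j)) * (INR (S j) * (y - c) ^ j)) <= eps * Rabs (x - c) ^ j).
    { intros y Hy Hyx.
      assert (HS : INR (S j) <> 0) by (apply not_0_INR; lia).
      replace (f y + - (L / INR (S j)) * (INR (S j) * (y - c) ^ j))
        with (f y - L * (y - c) ^ j) by (field; assumption).
      eapply Rle_trans; [apply Hd; [change (Rabs (y - c) < d); lra | assumption] |].
      apply Rmult_le_compat_l; [lra |]. apply pow_incr. split; [apply Rabs_pos | assumption]. }
    destruct Hc as [Hc1 Hc2]. destruct HxI as [Hx1 Hx2].
    (* Here [u] stands for the derivative of the corrected primitive at the intermediate point, so
       that both sides of [c] are finished in the same way. *)
    assert (Hfin : forall u, F x + - (L / INR (S j)) * (x - c) ^ S j
        = u * (x - c) -> Rabs u <= eps * Rabs (x - c) ^ j ->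
        Rabs (F x - L / INR (S j) * (x - c) ^ S j) <= eps * Rabs (x - c) ^ S j).
    { intros u Hu Hub.
      replace (F x - L / INR (S j) * (x - c) ^ S j) with (u * (x - c)) by (rewrite <- Hu; ring).
      rewrite Rabs_mult. change (Rabs (x - c) ^ S j) with (Rabs (x - c) * Rabs (x - c) ^ j).
      pose proof (Rmult_le_compat_r _ _ _ (Rabs_pos (x - c)) Hub). lra. }
    assert (H0 : F c + - (L / INR (S j)) * (c - c) ^ S j = 0).
    { rewrite HFc, Rminus_diag, pow_i by lia. ring. }
    destruct (Rtotal_order x c) as [Hlt | [-> | Hgt]].
    + destruct (real_mvt _ _ x c HG Hx1 Hlt Hc2) as [y [Hy Heq]].
      eapply Hfin; [| apply (Hkey y); [split; lra |]].
      * cbv beta in Heq. rewrite H0 in Heq. lra.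
      * rewrite !Rabs_left by lra. lra.
    + rewrite HFc, Rminus_diag, pow_i, Rabs_R0, pow_i by lia.
      rewrite Rmult_0_r, Rminus_0_r, Rabs_R0. lra.
    + destruct (real_mvt _ _ c x HG Hc1 Hgt Hx2) as [y [Hy Heq]].
      eapply Hfin; [| apply (Hkey y); [split; lra |]].
      * cbv beta in Heq. rewrite H0 in Heq. lra.
      * rewrite !Rabs_right by lra. lra.
Qed.

(** * Sign and coefficients of derivatives expanded in a basis *)

Lemma real_derive_increasing (f : R -> R) (c l : R) : Icc a b c ->
  (forall x y, Icc a b x -> Icc a b y -> x < y -> f x <= f y) ->
  real_derive f c l -> 0 <= l.
Proof.
  intros Hc Hf [_ H]. destruct (Rle_lt_dec 0 l) as [| Hl]; [assumption | exfalso].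
  (* With half of |l| as tolerance, the difference quotient at a nearby point is still negative,
     against monotonicity on whichever side of [c] the point lies. *)
  assert (He : 0 < - l / 2) by lra.
  destruct (near_punctured c _ Hc (H ltac:(lia) _ He)) as [x [Hx [Hne Hle]]].
  rewrite !pow_1 in Hle.
  destruct (Rlt_dec x c) as [Hxc | Hxc].
  - pose proof (Hf x c Hx Hc Hxc). rewrite (Rabs_left (x - c)) in Hle by lra.
    apply Rabs_le_between in Hle. nra.
  - assert (Hcx : c < x) by lra.
    pose proof (Hf c x Hc Hx Hcx). rewrite (Rabs_right (x - c)) in Hle by lra.
    apply Rabs_le_between in Hle. nra.
Qed.

Lemma real_derive_sum (f : nat -> R -> R) (c : R) (l : nat -> R) (m n : nat) :
  Icc a b c -> (forall i, (m <= i <= n)%nat -> real_derive (f i) c (l i)) ->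
  real_derive (fun x => sum_n_m (fun i => f i x) m n) c (sum_n_m l m n).
Proof.
  intros Hc H.
  destruct (le_lt_dec m n) as [Hmn | Hmn].
  - induction Hmn as [| n Hmn IH].
    + rewrite sum_n_n. eapply real_derive_ext; [assumption | | apply (H m); lia].
      intros x _. now rewrite sum_n_n.
    + rewrite sum_n_Sm by lia.
      eapply real_derive_ext; [assumption | |
        apply real_derive_plus; [assumption | apply IH; intros; apply H; lia | apply (H (S n)); lia]].
      intros x _. now rewrite sum_n_Sm by lia.
  - rewrite sum_n_m_zero by assumption.
    eapply real_derive_ext; [assumption | | apply real_derive_const; assumption].
    intros x _. now rewrite sum_n_m_zero by assumption.
Qed.

(** Strong induction on the order [d i]. Once the coefficients of lower order are known to vanish,
    the derivative has leading coefficient r i M i in order d i. Integration puts it, divided by d i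
    + 1, in order d i + 1 < k of [F], where the coefficient is 0. *)
Lemma derive_coeff_zero (q : nat -> R -> R) (d : nat -> nat) (M r : nat -> R) (N : nat)
    (c : R) (F : R -> R) (k : nat) (L : R) :
  Icc a b c ->
  (forall i j, (i <= N)%nat -> (j <= N)%nat -> d i = d j -> i = j) ->
  (forall i, (i <= N)%nat -> leading_term (q i) c (d i) (M i) /\ M i <> 0) ->
  (forall x, Icc a b x -> real_derive F x (sum_n (fun i => r i * q i x) N)) ->
  leading_term F c k L ->
  forall i, (i <= N)%nat -> (S (d i) < k)%nat -> r i = 0.
Proof.
  intros Hc Hd Hq HF HFk i. remember (d i) as m eqn:Hm. revert i Hm.
  induction m as [m IH] using lt_wf_ind. intros i -> Hi Hk.
  (* Terms of lower order drop out by induction and terms of higher order contribute 0. As the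
     orders are distinct, only index [i] contributes in order [d i]. *)
  set (L' := fun j => if Nat.eq_dec (d j) (d i) then r j * M j else 0).
  assert (Hsum : leading_term (fun x => sum_n (fun j => r j * q j x) N) c (d i) (sum_n L' N)).
  { apply (leading_term_sum (fun j x => r j * q j x)). intros j [_ Hj]. unfold L'.
    destruct (Hq j Hj) as [Hqj _].
    destruct (Nat.eq_dec (d j) (d i)) as [<- | Hne]; [now apply leading_term_scal |].
    destruct (lt_dec (d j) (d i)) as [Hlt | Hge].
    - eapply leading_term_ext; [assumption | | apply leading_term_zero].
      intros x _. rewrite (IH (d j) Hlt j eq_refl Hj); [ring | lia].
    - eapply (leading_term_weaken _ _ _ (d j)); [lia |]. apply leading_term_scal. exact Hqj. }
  rewrite (sum_n_single L' N i Hi) in Hsum.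
  2: { intros j Hj Hne. unfold L'. destruct Nat.eq_dec as [He |]; [| reflexivity].
       exfalso. apply Hne. now apply Hd. }
  unfold L' in Hsum. destruct (Nat.eq_dec (d i) (d i)) as [_ | []]; [| reflexivity].
  apply (leading_term_primitive F) in Hsum; [| assumption | assumption |].
  2: { eapply leading_term_vanish; [| exact HFk]. lia. }
  pose proof (leading_term_unique _ _ _ _ _ Hc Hsum (leading_term_weaken _ _ _ _ _ Hk HFk)) as H0.
  assert (HS : INR (S (d i)) <> 0) by (apply not_0_INR; lia).
  destruct (Hq i Hi) as [_ HM].
  apply (Rmult_eq_compat_r (INR (S (d i)))) in H0.
  replace (r i * M i / INR (S (d i)) * INR (S (d i))) with (r i * M i) in H0 by (field; assumption).
  rewrite Rmult_0_l in H0. apply Rmult_integral in H0. tauto.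
Qed.

(* The partial sum up to [j] is 1 up to order [j + 1] at [a] and 0 up to order [N + 1 - j] at [b];
   only [q j] has compatible zeros, and the sign comes from the mean value theorem. *)
Lemma partial_sum_derive (N : nat) (w q : nat -> R -> R) :
  (forall k, (k <= S N)%nat ->
     (exists L, leading_term (w k) a k L) /\ (exists L, leading_term (w k) b (S N - k) L)) ->
  (forall x, Icc a b x -> sum_n (fun k => w k x) (S N) = 1) ->
  (forall k, (k <= S N)%nat -> exists r, forall x, Icc a b x ->
     real_derive (w k) x (sum_n (fun i => r i * q i x) N)) ->
  (forall j, (j <= N)%nat ->
     (exists M, leading_term (q j) a j M /\ M <> 0) /\
     (exists M, leading_term (q j) b (N - j) M /\ M <> 0)) ->
  (forall j x, (j <= N)%nat -> a < x < b -> 0 < q j x) ->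
  forall j, (j <= N)%nat -> exists c, 0 < c /\ forall x, Icc a b x ->
    real_derive (fun x => sum_n (fun i => w i x) j) x (- c * q j x).
Proof.
  intros Hw Hw1 Hwd Hq Hqpos j Hj.
  assert (Ha : Icc a b a) by (split; lra). assert (Hb : Icc a b b) by (split; lra).
  assert (Hr : exists r, forall x, Icc a b x ->
    real_derive (fun x => sum_n (fun i => w i x) j) x (sum_n (fun i => r i * q i x) N)).
  { clear Hw Hw1 Hq Hqpos. induction j as [| j IH].
    - destruct (Hwd 0%nat) as [r Hr]; [lia |]. exists r. intros x Hx.
      eapply real_derive_ext; [assumption | | now apply Hr].
      intros y _. now rewrite sum_O.
    - destruct IH as [r Hr]; [lia |]. destruct (Hwd (S j)) as [r' Hr']; [lia |].
      exists (fun i => r i + r' i). intros x Hx.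
      replace (sum_n (fun i => (r i + r' i) * q i x) N)
        with (sum_n (fun i => r i * q i x) N + sum_n (fun i => r' i * q i x) N).
      + eapply real_derive_ext; [assumption | |
          apply real_derive_plus; [assumption | now apply Hr | now apply Hr']].
        intros y _. now rewrite sum_Sn.
      + change Rplus with (@plus R_AbelianMonoid) at 1. rewrite <- sum_n_plus.
        apply sum_n_ext. intros i. unfold plus; simpl. ring. }
  destruct Hr as [r Hr].
  destruct (finite_choice 0 _ N (fun i Hi => proj1 (Hq i Hi))) as [Ma HMa].
  destruct (finite_choice 0 _ N (fun i Hi => proj2 (Hq i Hi))) as [Mb HMb].
  destruct (finite_choice 0 _ (S N) (fun i Hi => proj1 (Hw i Hi))) as [La HLa].
  destruct (finite_choice 0 _ (S N) (fun i Hi => proj2 (Hw i Hi))) as [Lb HLb].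
  (* For i < j the function [w i] vanishes at [b] to higher order than S N - j, so only i = j can
     contribute. *)
  assert (HSb : leading_term (fun x => sum_n (fun i => w i x) j) b (S N - j)
      (sum_n (fun i => if Nat.eq_dec i j then Lb i else 0) j)).
  { apply (leading_term_sum w). intros i [_ Hi].
    destruct (Nat.eq_dec i j) as [-> | Hne]; [apply HLb; lia |].
    eapply (leading_term_weaken _ _ _ (S N - i)); [lia | apply HLb; lia]. }
  (* The partial sum minus 1 is the negative of w (j+1) + ... + w (N+1), all of whose terms have
     order at least j + 1 at [a]. *)
  assert (HSa : exists L, leading_term (fun x => sum_n (fun i => w i x) j - 1) a (S j) L).
  { exists (-1 * sum_n_m (fun i => if Nat.eq_dec i (S j) then La i else 0) (S j) (S N)).
    eapply leading_term_ext; [assumption | | apply leading_term_scal, (leading_term_sum w)].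
    - intros x Hx. cbv beta. rewrite <- (Hw1 x Hx).
      rewrite (sum_n_m_sum_n (G := R_AbelianGroup)) by lia.
      change (@minus R_AbelianGroup) with Rminus.
      change (AbelianGroup.AbelianMonoid R_AbelianGroup) with R_AbelianMonoid. ring.
    - intros i Hi. destruct (Nat.eq_dec i (S j)) as [-> | Hne]; [apply HLa; lia |].
      eapply (leading_term_weaken _ _ _ i); [lia | apply HLa; lia]. }
  destruct HSa as [L HSa].
  (* The zero at [a] excludes i < j, since i + 1 < j + 1. The zero at [b] excludes i > j, since N -
     i + 1 < N + 1 - j. *)
  assert (Hrj : forall i, (i <= N)%nat -> i <> j -> r i = 0).
  { intros i Hi Hne. destruct (lt_dec i j) as [Hlt | Hge].
    - apply (derive_coeff_zero q (fun i => i) Ma r N a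
        (fun x => sum_n (fun i => w i x) j - 1) (S j) L); try assumption.
      + tauto.
      + intros x Hx. rewrite <- (Rplus_0_r (sum_n _ N)).
        apply (real_derive_plus (fun x => sum_n (fun i => w i x) j) (fun _ => Ropp 1));
          [assumption | now apply Hr | now apply real_derive_const].
      + lia.
    - eapply (derive_coeff_zero q (fun i => (N - i)%nat) Mb r N b); try eassumption.
      + intros; lia.
      + lia. }
  assert (Hr' : forall x, Icc a b x ->
    real_derive (fun x => sum_n (fun i => w i x) j) x (- - r j * q j x)).
  { intros x Hx. rewrite Ropp_involutive.
    rewrite <- (sum_n_single (fun i => r i * q i x) N j Hj); [now apply Hr |].
    intros i Hi Hne. rewrite Hrj by assumption. apply Rmult_0_l. }
  exists (- r j). split; [| assumption].
  (* The partial sum falls from 1 at [a] to 0 at [b], so - r j times the positive number q j y (b -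
     a) equals 1. *)
  destruct (real_mvt _ _ a b Hr' (Rle_refl a) hab (Rle_refl b)) as [y [Hy Heq]].
  pose proof (leading_term_vanish _ _ _ _ (Nat.lt_0_succ j) HSa) as HSa0.
  assert (Hjb : (0 < S N - j)%nat) by lia.
  pose proof (leading_term_vanish _ _ _ _ Hjb HSb) as HSb0.
  cbv beta in *. pose proof (Hqpos j y Hj Hy) as Hqy.
  assert (H1 : - r j * q j y * (b - a) = 1) by lra.
  apply Rmult_lt_reg_r with (q j y * (b - a)); [apply Rmult_lt_0_compat; lra | lra].
Qed.

(** The constant [tau (S N)] left by Abel summation has derivative 0, and the minus sign from
    [partial_sum_derive] turns tau j - tau (S j) into the forward difference. *)
Lemma node_sum_derive (N : nat) (w q : nat -> R -> R) (tau : nat -> R) (phi : R -> R) :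
  (forall k, (k <= S N)%nat ->
     (exists L, leading_term (w k) a k L) /\ (exists L, leading_term (w k) b (S N - k) L)) ->
  (forall x, Icc a b x -> sum_n (fun k => w k x) (S N) = 1) ->
  (forall x, Icc a b x -> sum_n (fun k => tau k * w k x) (S N) = phi x) ->
  (forall k, (k <= S N)%nat -> exists r, forall x, Icc a b x ->
     real_derive (w k) x (sum_n (fun i => r i * q i x) N)) ->
  (forall j, (j <= N)%nat ->
     (exists M, leading_term (q j) a j M /\ M <> 0) /\
     (exists M, leading_term (q j) b (N - j) M /\ M <> 0)) ->
  (forall j x, (j <= N)%nat -> a < x < b -> 0 < q j x) ->
  exists c, (forall j, (j <= N)%nat -> 0 < c j) /\ forall x, Icc a b x ->
    real_derive phi x (sum_n (fun j => (tau (S j) - tau j) * c j * q j x) N).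
Proof.
  intros Hw Hw1 Hphi Hwd Hq Hqpos.
  destruct (finite_choice 0 _ N (partial_sum_derive N w q Hw Hw1 Hwd Hq Hqpos)) as [c Hc].
  exists c. split; [intros j Hj; now apply Hc |].
  intros x Hx.
  eapply real_derive_ext; [assumption | |
    rewrite <- (Rplus_0_l (sum_n _ N)); apply real_derive_plus; [assumption |
      apply (real_derive_const (tau (S N))); assumption |
      apply (real_derive_sum (fun j x => (tau j - tau (S j)) * sum_n (fun i => w i x) j));
      [assumption |]]].
  - intros y Hy. cbv beta. rewrite <- (Hphi y Hy), abel_summation, Hw1 by assumption.
    now rewrite Rmult_1_r.
  - intros i [_ Hi].
    replace ((tau (S i) - tau i) * c i * q i x) with ((tau i - tau (S i)) * (- c i * q i x)) by ring.
    apply real_derive_scal; [assumption |]. now apply Hc.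
Qed.

(** A combination of positive functions with non-negative coefficients can fail to be positive only
    if all coefficients vanish. The mean value theorem would then give phi a = phi b. *)
Lemma derive_pos_interior (N : nat) (q : nat -> R -> R) (e : nat -> R) (phi : R -> R) :
  (forall j, (j <= N)%nat -> 0 <= e j) ->
  (forall j x, (j <= N)%nat -> a < x < b -> 0 < q j x) ->
  (forall x, Icc a b x -> real_derive phi x (sum_n (fun j => e j * q j x) N)) ->
  phi a < phi b ->
  forall x, a < x < b -> 0 < sum_n (fun j => e j * q j x) N.
Proof.
  intros He Hq Hphi Hab x Hx.
  destruct (real_mvt _ _ a b Hphi (Rle_refl a) hab (Rle_refl b)) as [y [Hy Heq]].
  assert (Hj : ~ forall j, (j <= N)%nat -> e j = 0).
  { intros H0. cbv beta in Heq.
    rewrite (sum_n_ext_loc _ (fun _ => 0)) in Heq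
      by (intros j Hj; rewrite H0 by assumption; apply Rmult_0_l).
    rewrite sum_n_const in Heq. lra. }
  destruct (Rlt_le_dec 0 (sum_n (fun j => e j * q j x) N)) as [| Hle]; [assumption |].
  exfalso. apply Hj. intros j HjN. destruct (He j HjN) as [Hlt | <-]; [exfalso | reflexivity].
  apply (Rle_not_lt _ _ Hle), (sum_n_pos _ N j HjN).
  - apply Rmult_lt_0_compat; [assumption | now apply Hq].
  - intros i Hi. apply Rmult_le_pos; [now apply He | now left; apply Hq].
Qed.

(** At the endpoint only the basis function of order 0 survives, so the derivative equals e j M j,
    which is nonzero. Its sign comes from the monotonicity of [phi], as positivity of the basis is
    assumed on the open interval only. *)
Lemma derive_pos_endpoint (N : nat) (q : nat -> R -> R) (d : nat -> nat) (e M : nat -> R)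
    (phi : R -> R) (c : R) (j : nat) :
  Icc a b c -> (j <= N)%nat -> e j <> 0 -> M j <> 0 -> d j = 0%nat ->
  (forall i, (i <= N)%nat -> i <> j -> (0 < d i)%nat) ->
  (forall i, (i <= N)%nat -> leading_term (q i) c (d i) (M i)) ->
  (forall x y, Icc a b x -> Icc a b y -> x < y -> phi x <= phi y) ->
  real_derive phi c (sum_n (fun j => e j * q j c) N) ->
  0 < sum_n (fun j => e j * q j c) N.
Proof.
  intros Hc Hj He HM Hdj Hd Hq Hphi Hder.
  pose proof (real_derive_increasing _ _ _ Hc Hphi Hder) as Hnn.
  rewrite (sum_n_single _ N j Hj) in Hnn |- *.
  2, 3: intros i Hi Hne; rewrite (leading_term_vanish _ _ _ _ (Hd i Hi Hne) (Hq i Hi));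
        apply Rmult_0_r.
  assert (Hqj : q j c = M j).
  { destruct (Hq j Hj) as [-> _]. rewrite Hdj. simpl. ring. }
  rewrite Hqj in *. destruct Hnn as [| H0]; [assumption |].
  exfalso. symmetry in H0. apply Rmult_integral in H0. tauto.
Qed.

End Interval.

(** * Real and imaginary parts of scalars *)

Definition Kre {K : scalars} : K -> R :=
  match K return scalar_space K -> R with
  | real_scalars => fun z => z
  | complex_scalars => fst
  end.

Definition Kim {K : scalars} : K -> R :=
  match K return scalar_space K -> R with
  | real_scalars => fun _ => 0
  | complex_scalars => snd
  end.

Lemma is_linear_Kre (K : scalars) : is_linear (V := R_NormedModule) (Kre (K := K)).
Proof.
  destruct K; [apply is_linear_id | apply (@is_linear_fst R_AbsRing R_NormedModule R_NormedModule)].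
Qed.

Lemma is_linear_Kim (K : scalars) : is_linear (V := R_NormedModule) (Kim (K := K)).
Proof.
  destruct K; [exact (is_linear_zero (U := R_NormedModule) (V := R_NormedModule)) |
    apply (@is_linear_snd R_AbsRing R_NormedModule R_NormedModule)].
Qed.

Lemma is_linear_RtoK (K : scalars) : is_linear (U := R_NormedModule) (RtoK (K := K)).
Proof.
  destruct K; [apply is_linear_id |].
  apply (is_linear_prod (T := R_NormedModule) (U := R_NormedModule) (V := R_NormedModule)
    (fun x => x) (fun _ => 0)).
  - apply is_linear_id.
  - exact (is_linear_zero (U := R_NormedModule) (V := R_NormedModule)).
Qed.

Lemma K_ext {K : scalars} (z w : K) : Kre z = Kre w -> Kim z = Kim w -> z = w.
Proof.
  destruct K; simpl; [auto |]. destruct z, w; simpl. congruence.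
Qed.

Lemma Kre_RtoK (K : scalars) (r : R) : Kre (RtoK (K := K) r) = r.
Proof. now destruct K. Qed.

Lemma Kim_RtoK (K : scalars) (r : R) : Kim (RtoK (K := K) r) = 0.
Proof. now destruct K. Qed.

Lemma RtoK_Kre {K : scalars} (z : K) : Kim z = 0 -> z = RtoK (Kre z).
Proof.
  intros Hz. apply K_ext; [now rewrite Kre_RtoK | now rewrite Kim_RtoK].
Qed.

Lemma RtoK_zero (K : scalars) : RtoK 0 = zero :> K.
Proof. now destruct K. Qed.

Lemma Kre_mult {K : scalars} (z w : K) : Kre (Kmult z w) = Kre z * Kre w - Kim z * Kim w.
Proof. destruct K; simpl; [ring | reflexivity]. Qed.

Lemma Kre_div {K : scalars} (z w : K) : Kim w = 0 -> Kre w <> 0 ->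
  Kre (Kdiv z w) = Kre z / Kre w.
Proof.
  destruct K; simpl; [reflexivity |]. destruct z as [z1 z2], w as [w1 w2]; simpl.
  intros -> Hw. field. assumption.
Qed.

Lemma Kim_div {K : scalars} (z w : K) : Kim w = 0 -> Kre w <> 0 ->
  Kim (Kdiv z w) = Kim z / Kre w.
Proof.
  destruct K; simpl; [intros; unfold Rdiv; ring |].
  destruct z as [z1 z2], w as [w1 w2]; simpl. intros -> Hw. field. assumption.
Qed.

Lemma Kre_sum_n {K : scalars} (u : nat -> K) (n : nat) :
  Kre (sum_n u n) = sum_n (fun k => Kre (u k)) n.
Proof.
  induction n as [| n IH]; [now rewrite !sum_O |].
  rewrite !sum_Sn, <- IH. apply (linear_plus _ (is_linear_Kre K)).
Qed.

Lemma Klt_inv {K : scalars} (z w : K) : Klt z w -> Kim z = 0 /\ Kim w = 0 /\ Kre z < Kre w.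
Proof.
  intros [r [s [-> [-> H]]]]. now rewrite !Kre_RtoK, !Kim_RtoK.
Qed.

Lemma Klt_zero_inv {K : scalars} (z : K) : Klt zero z -> Kim z = 0 /\ 0 < Kre z.
Proof.
  intros H. apply Klt_inv in H. rewrite <- RtoK_zero, Kre_RtoK in H. tauto.
Qed.

Lemma Kle_zero_Kim {K : scalars} (z : K) : Kle zero z -> Kim z = 0.
Proof.
  intros [r [s [_ [-> _]]]]. apply Kim_RtoK.
Qed.

(** * Passage between scalar-valued and real derivatives *)

Section ScalarFunctions.

Variables (K : scalars) (a b : R).
Hypothesis hab : a < b.

Lemma is_filter_lim_within (x : R) : is_filter_lim (within (Icc a b) (locally x)) x.
Proof.
  intros P HP. now apply filter_le_within.
Qed.

(** [filterdiff] quantifies over all limit points of the filter. This filter is proper by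
    [near_punctured], so it has just one. *)
Lemma is_filter_lim_within_unique (x y : R) : Icc a b x ->
  is_filter_lim (within (Icc a b) (locally x)) y -> y = x.
Proof.
  intros Hx Hy.
  assert (HF : ProperFilter' (within (Icc a b) (locally x))).
  { split; [| apply within_filter, locally_filter].
    intros H. now destruct (near_punctured a b hab x _ Hx H) as [z [_ [_ []]]]. }
  apply (is_filter_lim_unique (V := R_NormedModule) (F := within (Icc a b) (locally x)));
    [exact Hy | apply is_filter_lim_within].
Qed.

(** Applied to [Kre] and [Kim], this reduces statements about derivatives in [K] to real ones. *)
Lemma is_derive_on_linear (pi : K -> R) (f : R -> K) (x : R) (l : K) :
  is_linear (V := R_NormedModule) pi -> is_derive_on a b f x l ->
  real_derive a b (fun y => pi (f y)) x (pi l).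
Proof.
  intros Hpi Hf.
  destruct (filterdiff_comp f pi _ _ Hf (filterdiff_linear pi Hpi)) as [_ H].
  specialize (H x (is_filter_lim_within x)). split; [simpl; ring |].
  intros _ eps Heps. generalize (H (mkposreal eps Heps)). apply filter_imp.
  intros y Hy. rewrite !pow_1. rewrite (linear_scal _ Hpi), (Rmult_comm (pi l)) in *. exact Hy.
Qed.

Lemma is_derive_on_RtoK (phi : R -> R) (f : R -> K) (x l : R) : Icc a b x ->
  (forall y, Icc a b y -> f y = RtoK (phi y)) ->
  real_derive a b phi x l -> is_derive_on a b f x (RtoK l).
Proof.
  intros Hx Hf [_ H].
  assert (Hphi : filterdiff (U := R_NormedModule) (V := R_NormedModule) phi
    (within (Icc a b) (locally x)) (fun h => scal h l)).
  { split; [apply (is_linear_scal_l (K := R_AbsRing) (V := R_NormedModule) l) |].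
    intros y Hy. rewrite (is_filter_lim_within_unique x y Hx Hy).
    intros eps. generalize (H Nat.lt_0_1 eps (cond_pos eps)). apply filter_imp.
    intros z Hz. rewrite !pow_1, (Rmult_comm l) in Hz. exact Hz. }
  pose proof (filterdiff_comp _ _ _ _ Hphi (filterdiff_linear _ (is_linear_RtoK K))) as Hc.
  eapply filterdiff_ext_lin.
  - eapply filterdiff_ext_loc; [| | exact Hc].
    + exists (mkposreal 1 Rlt_0_1). intros y _ Hy. symmetry. now apply Hf.
    + intros y Hy. rewrite (is_filter_lim_within_unique x y Hx Hy). symmetry. now apply Hf.
  - intros h. apply (linear_scal _ (is_linear_RtoK K)).
Qed.

Lemma is_derive_on_ext (f g : R -> K) (x : R) (l : K) : Icc a b x -> eq_on a b f g ->
  is_derive_on a b f x l -> is_derive_on a b g x l.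
Proof.
  intros Hx Hfg. apply filterdiff_ext_loc.
  - exists (mkposreal 1 Rlt_0_1). intros y _ Hy. now apply Hfg.
  - intros y Hy. rewrite (is_filter_lim_within_unique x y Hx Hy). now apply Hfg.
Qed.

Lemma is_derive_on_continuous_on (f g : R -> K) :
  (forall x, Icc a b x -> is_derive_on a b f x (g x)) -> continuous_on (Icc a b) f.
Proof.
  intros H x Hx.
  apply (filterdiff_continuous_aux (U := R_NormedModule) (F := within (Icc a b) (locally x)) f).
  - eexists. exact (H x Hx).
  - apply is_filter_lim_within.
Qed.

Lemma nth_derive_ex_derive (i : nat) (f g : R -> K) : is_nth_derive_on a b (S i) f g ->
  exists h, forall x, Icc a b x -> is_derive_on a b f x (h x).
Proof.
  revert g. induction i as [| i IH]; intros g [h [Hh Hg]].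
  - exists g. intros x Hx. eapply is_derive_on_ext; [assumption | | exact (Hg x Hx)].
    intros y Hy. symmetry. now apply Hh.
  - now apply (IH h).
Qed.

Lemma nth_derive_Kim (i : nat) (f g : R -> K) : is_nth_derive_on a b i f g ->
  (forall x, Icc a b x -> Kim (f x) = 0) -> forall x, Icc a b x -> Kim (g x) = 0.
Proof.
  intros Hfg Hf. revert g Hfg. induction i as [| i IH]; intros g Hg x Hx.
  - rewrite <- (Hg x Hx). now apply Hf.
  - destruct Hg as [h [Hh Hg]].
    apply (real_derive_unique a b hab (fun y => Kim (h y)) x); [assumption | |].
    + apply is_derive_on_linear; [apply is_linear_Kim | now apply Hg].
    + apply (real_derive_ext a b (fun _ => 0)); [assumption | | now apply real_derive_const].
      intros y Hy. symmetry. now apply (IH h).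
Qed.

Lemma nth_derive_Kre_unique (i : nat) (f g g' : R -> K) :
  is_nth_derive_on a b i f g -> is_nth_derive_on a b i f g' ->
  forall x, Icc a b x -> Kre (g x) = Kre (g' x).
Proof.
  revert g g'. induction i as [| i IH]; intros g g' Hg Hg' x Hx.
  - now rewrite <- (Hg x Hx), <- (Hg' x Hx).
  - destruct Hg as [h [Hh Hg]], Hg' as [h' [Hh' Hg']].
    apply (real_derive_unique a b hab (fun y => Kre (h y)) x); [assumption | |].
    + apply is_derive_on_linear; [apply is_linear_Kre | now apply Hg].
    + apply (real_derive_ext a b (fun y => Kre (h' y))); [assumption | |].
      * intros y Hy. now apply IH.
      * apply is_derive_on_linear; [apply is_linear_Kre | now apply Hg'].
Qed.

(** Descends from the j-th derivative to [f] by one use of [leading_term_primitive] per order. The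
    factor [kappa] collects the divisors m + 1, ..., m + j; only its positivity is recorded. *)
Lemma nth_derive_leading_term (c : R) (j : nat) (f g : R -> K) : Icc a b c ->
  is_nth_derive_on a b j f g ->
  (forall i, (i < j)%nat -> exists h, is_nth_derive_on a b i f h /\ h c = zero) ->
  forall m L, leading_term a b (fun x => Kre (g x)) c m L ->
  exists kappa, 0 < kappa /\ leading_term a b (fun x => Kre (f x)) c (m + j) (kappa * L).
Proof.
  intros Hc. revert g. induction j as [| j IH]; intros g Hg Hz m L HL.
  - exists 1. split; [lra |]. rewrite Nat.add_0_r, Rmult_1_l.
    eapply leading_term_ext; [assumption | | exact HL].
    intros x Hx. cbv beta. now rewrite (Hg x Hx).
  - destruct Hg as [h [Hh Hg]].
    destruct (Hz j) as [h' [Hh' Hc0]]; [lia |].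
    apply (leading_term_primitive a b hab (fun x => Kre (h x))) in HL; [| assumption | |].
    + destruct (IH h Hh (fun i Hi => Hz i (Nat.lt_lt_succ_r _ _ Hi)) _ _ HL) as [kappa [Hk HLk]].
      exists (kappa / INR (S m)).
      assert (HS : 0 < INR (S m)) by (apply lt_0_INR; lia).
      split; [now apply Rdiv_lt_0_compat |].
      rewrite Nat.add_succ_r.
      replace (kappa / INR (S m) * L) with (kappa * (L / INR (S m))) by (field; lra).
      exact HLk.
    + intros x Hx. apply is_derive_on_linear; [apply is_linear_Kre | now apply Hg].
    (* Vanishing at [c] is known for some j-th derivative [h']; uniqueness carries it over to the
       [h] of the present chain. *)
    + rewrite (nth_derive_Kre_unique j f h h' Hh Hh' c Hc), Hc0.
      now rewrite <- RtoK_zero, Kre_RtoK.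
Qed.

Lemma zero_of_order_leading_term (f : R -> K) (j : nat) (c : R) : Icc a b c ->
  (forall x, Icc a b x -> Kim (f x) = 0) -> zero_of_order a b f j c ->
  exists M, leading_term a b (fun x => Kre (f x)) c j M /\ M <> 0.
Proof.
  intros Hc Hf [Hz [g [Hg Hgc]]].
  (* The descent starts from order 0, where a leading term is just the value at [c]. As [g c] is
     real and nonzero, so is its real part. *)
  assert (H0 : leading_term a b (fun x => Kre (g x)) c 0 (Kre (g c))).
  { split; [simpl; ring | lia]. }
  destruct (nth_derive_leading_term c j f g Hc Hg Hz _ _ H0) as [kappa [Hk HL]].
  exists (kappa * Kre (g c)). split; [exact HL |].
  apply Rmult_integral_contrapositive. split; [lra |]. intros H. apply Hgc.
  rewrite (RtoK_Kre (g c)), H; [apply RtoK_zero |].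
  now apply (nth_derive_Kim j f g).
Qed.

(* A derivative need not be continuous, so the endpoints are reached by integrating. *)
Lemma derive_Kim_zero (f g : R -> K) :
  (forall x, Icc a b x -> is_derive_on a b f x (g x)) ->
  (forall x, a < x < b -> Kim (g x) = 0) -> forall x, Icc a b x -> Kim (g x) = 0.
Proof.
  intros Hf Hg.
  assert (Hd : forall x, Icc a b x -> real_derive a b (fun y => Kim (f y)) x (Kim (g x))).
  { intros x Hx. apply is_derive_on_linear; [apply is_linear_Kim | now apply Hf]. }
  assert (Hcst : forall x, Icc a b x -> Kim (f a) = Kim (f x)).
  { intros x [[Hax | <-] Hxb]; [| reflexivity].
    destruct (real_mvt a b hab _ _ a x Hd (Rle_refl a) Hax Hxb) as [y [Hy Heq]].
    cbv beta in Heq. rewrite Hg in Heq by lra. lra. }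
  intros x Hx. apply (real_derive_unique a b hab (fun y => Kim (f y)) x);
    [assumption | now apply Hd |].
  apply (real_derive_ext a b (fun _ => Kim (f a))); [assumption | exact Hcst |].
  now apply real_derive_const.
Qed.

(** * Quotients by f0 and operators fixing f0 and f1 *)

Section BernsteinOperator.

Variables (N : nat) (U : (R -> K) -> Prop) (f0 : R -> K) (q : nat -> R -> K).
Hypothesis hU : is_Cm_subspace a b (S N) U.
Hypothesis hf0 : U f0.
Hypothesis hpos : forall x, Icc a b x -> Klt zero (f0 x).
Hypothesis hq : pos_Bernstein_basis a b (D_space a b f0 U) N q.

Lemma U_ex_derive (f : R -> K) : U f ->
  exists h, forall x, Icc a b x -> is_derive_on a b f x (h x).
Proof.
  intros Hf. destruct hU as [_ [HC _]]. destruct (HC f Hf) as [g [Hg _]].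
  now apply (nth_derive_ex_derive N f g).
Qed.

Lemma Kre_quot (f : R -> K) (x : R) : Icc a b x ->
  Kre (quot f f0 x) = Kre (f x) / Kre (f0 x).
Proof.
  intros Hx. destruct (Klt_zero_inv _ (hpos x Hx)) as [H1 H2].
  apply Kre_div; [assumption | lra].
Qed.

Lemma quot_real (f : R -> K) (x : R) : Icc a b x -> Kim (f x) = 0 ->
  quot f f0 x = RtoK (Kre (f x) / Kre (f0 x)).
Proof.
  intros Hx Hf. destruct (Klt_zero_inv _ (hpos x Hx)) as [H1 H2].
  rewrite <- Kre_quot by assumption. apply RtoK_Kre.
  unfold quot. rewrite Kim_div by (assumption || lra). rewrite Hf. unfold Rdiv. ring.
Qed.

(** Positivity makes [q j] real on the open interval. Being the derivative of a quotient, it is then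
    real at [a] and [b] too, by [derive_Kim_zero]. *)
Lemma D_basis_real (j : nat) (x : R) : (j <= N)%nat -> Icc a b x -> Kim (q j x) = 0.
Proof.
  intros Hj. destruct hq as [[[HV _] _] Hpos].
  destruct (HV j Hj) as [f [_ Hf]].
  apply (derive_Kim_zero (quot f f0)); [exact Hf |].
  intros y Hy. exact (proj1 (Klt_zero_inv _ (Hpos j y Hj Hy))).
Qed.

Lemma D_basis_leading_term (j : nat) : (j <= N)%nat ->
  (exists M, leading_term a b (fun x => Kre (q j x)) a j M /\ M <> 0) /\
  (exists M, leading_term a b (fun x => Kre (q j x)) b (N - j) M /\ M <> 0).
Proof.
  intros Hj. destruct hq as [[_ Hz] _]. destruct (Hz j Hj) as [Hza Hzb].
  split; (apply zero_of_order_leading_term;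
    [split; lra | intros x; now apply D_basis_real | assumption]).
Qed.

Lemma D_basis_pos (j : nat) (x : R) : (j <= N)%nat -> a < x < b -> 0 < Kre (q j x).
Proof.
  intros Hj Hx. destruct hq as [_ Hpos]. exact (proj2 (Klt_zero_inv _ (Hpos j x Hj Hx))).
Qed.

(** The derivative of f/f0 lies in [D_space], hence expands in the [q i] over [K]. As both it and
    the [q i] are real, the coefficients may be replaced by their real parts. *)
Lemma quot_derive_combination (f : R -> K) : U f ->
  (forall x, Icc a b x -> Kim (f x) = 0) ->
  exists r, forall x, Icc a b x ->
    real_derive a b (fun y => Kre (f y) / Kre (f0 y)) x (sum_n (fun i => r i * Kre (q i x)) N).
Proof.
  intros Hf Hfr.
  destruct (U_ex_derive f Hf) as [h Hh]. destruct (U_ex_derive f0 hf0) as [h0 Hh0].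
  set (l := fun x => (Kre (h x) * Kre (f0 x) - Kre (f x) * Kre (h0 x)) / (Kre (f0 x) * Kre (f0 x))).
  assert (Hl : forall x, Icc a b x -> real_derive a b (fun y => Kre (f y) / Kre (f0 y)) x (l x)).
  { intros x Hx. apply (real_derive_div a b (fun y => Kre (f y)) (fun y => Kre (f0 y)));
      [assumption | | |].
    - intros y Hy. exact (proj2 (Klt_zero_inv _ (hpos y Hy))).
    - apply is_derive_on_linear; [apply is_linear_Kre | now apply Hh].
    - apply is_derive_on_linear; [apply is_linear_Kre | now apply Hh0]. }
  destruct hq as [[[_ [_ Hspan]] _] _].
  destruct (Hspan (fun x => RtoK (l x))) as [c Hc].
  { exists f. split; [assumption |]. intros x Hx.
    apply (is_derive_on_RtoK (fun y => Kre (f y) / Kre (f0 y))); [assumption | | now apply Hl].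
    intros y Hy. apply quot_real; auto. }
  exists (fun i => Kre (c i)). intros x Hx.
  replace (sum_n (fun i => Kre (c i) * Kre (q i x)) N) with (l x); [now apply Hl |].
  rewrite <- (Kre_RtoK K (l x)), (Hc x Hx), Kre_sum_n.
  apply sum_n_Rext. intros i Hi. rewrite Kre_mult, D_basis_real by assumption.
  ring.
Qed.

Lemma fixed_quot_derive (f1 : R -> K) (t : nat -> R) (B : (R -> K) -> (R -> K)) :
  U f1 -> is_gen_Bernstein_op a b (S N) U t B ->
  eq_on a b (B f0) f0 -> eq_on a b (B f1) f1 ->
  exists c, (forall j, (j <= N)%nat -> 0 < c j) /\ forall x, Icc a b x ->
    real_derive a b (fun y => Kre (quot f1 f0 y)) x
      (sum_n (fun j => (Kre (quot f1 f0 (t (S j))) - Kre (quot f1 f0 (t j))) * c j * Kre (q j x)) N).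
Proof.
  intros Hf1 [p [alpha [[[[HpU _] Hpz] Hpp] [Ht [Halpha HB]]]]] HB0 HB1.
  assert (Hpr : forall k x, (k <= S N)%nat -> Icc a b x -> Kim (p k x) = 0).
  { intros k x Hk Hx. apply Kle_zero_Kim. now apply Hpp. }
  assert (HF0 : forall x, Icc a b x -> 0 < Kre (f0 x)).
  { intros x Hx. exact (proj2 (Klt_zero_inv _ (hpos x Hx))). }
  (* This scaling comes from f (t k) = (f/f0)(t k) f0 (t k): dividing B f = f by [f0] gives f/f0 as
     the sum of the (f/f0)(t k) w k. For f = f0 the sum of the [w k] is 1. *)
  set (w := fun k x => Kre (f0 (t k)) * alpha k * (Kre (p k x) / Kre (f0 x))).
  assert (Hfix : forall f, U f -> eq_on a b (B f) f -> forall x, Icc a b x ->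
    Kre (f x) / Kre (f0 x) = sum_n (fun k => Kre (quot f f0 (t k)) * w k x) (S N)).
  { intros f Hf HBf x Hx. pose proof (HF0 x Hx).
    destruct (U_ex_derive f Hf) as [h Hh].
    rewrite <- (HBf x Hx), (HB f (is_derive_on_continuous_on f h Hh) x Hx), Kre_sum_n.
    unfold Rdiv. rewrite Rmult_comm, <- sum_n_Rmult_l.
    apply sum_n_Rext. intros k Hk. pose proof (HF0 (t k) (Ht k Hk)).
    rewrite Kre_mult, Hpr, Kre_mult, Kre_RtoK, Kim_RtoK, Kre_quot by auto.
    unfold w. field. lra. }
  apply (node_sum_derive a b hab N w (fun j x => Kre (q j x))
    (fun k => Kre (quot f1 f0 (t k)))).
  (* [w k] is a constant times [p k] times the continuous function 1/f0, so it keeps the orders of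
     [p k] at [a] and [b]. *)
  - assert (Hlt : forall k c i, (k <= S N)%nat -> Icc a b c -> zero_of_order a b (p k) i c ->
      exists L, leading_term a b (w k) c i L).
    { intros k c i Hk Hc Hz.
      destruct (zero_of_order_leading_term (p k) i c Hc (fun x => Hpr k x Hk) Hz) as [M [HM _]].
      eexists. apply leading_term_scal.
      apply (leading_term_mult a b _ (fun x => / Kre (f0 x))); [exact HM |].
      destruct (U_ex_derive f0 hf0) as [h0 Hh0].
      apply (filterlim_inv a b (fun x => Kre (f0 x))); [now apply HF0 |].
      apply (real_derive_continuous a b (fun x => Kre (f0 x)) c (Kre (h0 c))).
      apply is_derive_on_linear; [apply is_linear_Kre | now apply Hh0]. }
    intros k Hk. destruct (Hpz k Hk) as [Hza Hzb].
    split; (apply Hlt; [assumption | split; lra | assumption]).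
  - intros x Hx. pose proof (HF0 x Hx).
    transitivity (Kre (f0 x) / Kre (f0 x)); [| apply Rdiv_diag; lra].
    rewrite (Hfix f0 hf0 HB0 x Hx). apply sum_n_Rext. intros k Hk.
    pose proof (HF0 (t k) (Ht k Hk)). rewrite Kre_quot by auto. field. lra.
  - intros x Hx. rewrite Kre_quot by assumption. symmetry. now apply Hfix.
  - intros k Hk.
    destruct (quot_derive_combination (p k) (HpU k Hk) (fun x => Hpr k x Hk)) as [r Hr].
    exists (fun i => Kre (f0 (t k)) * alpha k * r i). intros x Hx.
    replace (sum_n (fun i => Kre (f0 (t k)) * alpha k * r i * Kre (q i x)) N)
      with (Kre (f0 (t k)) * alpha k * sum_n (fun i => r i * Kre (q i x)) N).
    + apply real_derive_scal; [assumption | now apply Hr].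
    + rewrite <- sum_n_Rmult_l. apply sum_n_Rext. intros i _. ring.
  - apply D_basis_leading_term.
  - apply D_basis_pos.
Qed.

End BernsteinOperator.

End ScalarFunctions.

(** * Positivity of the derivative in the interior and at the endpoints *)

Theorem corollary3p4 (a b : R) (hab : a < b) (n : nat) (hn : (1 <= n)%nat)
    (K : scalars) (U : (R -> K) -> Prop) (hU : is_Cm_subspace a b n U)
    (f0 f1 : R -> K) (hf0 : U f0) (hf1 : U f1)
    (hpos : forall x, Icc a b x -> Klt zero (f0 x))
    (hincr : forall x y, Icc a b x -> Icc a b y -> x < y ->
       Klt (quot f1 f0 x) (quot f1 f0 y))
    (hUB : exists p, nonneg_Bernstein_basis a b U n p)
    (hDB : exists q, pos_Bernstein_basis a b (D_space a b f0 U) (n - 1) q) :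
  ((exists (t : nat -> R) (B : (R -> K) -> (R -> K)),
      is_gen_Bernstein_op a b n U t B /\
      (forall k, (k < n)%nat -> t k <= t (S k)) /\
      eq_on a b (B f0) f0 /\ eq_on a b (B f1) f1) ->
   forall x, a < x < b ->
     exists l : K, is_derive_on a b (quot f1 f0) x l /\ Klt zero l)
  /\
  ((exists (t : nat -> R) (B : (R -> K) -> (R -> K)),
      is_gen_Bernstein_op a b n U t B /\
      (forall k, (k < n)%nat -> t k < t (S k)) /\
      eq_on a b (B f0) f0 /\ eq_on a b (B f1) f1) ->
   forall x, Icc a b x ->
     exists l : K, is_derive_on a b (quot f1 f0) x l /\ Klt zero l).
Proof.
  destruct n as [| N]; [lia |]. destruct hDB as [q hq].
  replace (S N - 1)%nat with N in hq by lia.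
  assert (Ha : Icc a b a) by (split; lra). assert (Hb : Icc a b b) by (split; lra).
  set (phi := fun x => Kre (quot f1 f0 x)).
  assert (Hmono : forall x y, Icc a b x -> Icc a b y -> x < y -> phi x < phi y).
  { intros x y Hx Hy Hxy. now destruct (Klt_inv _ _ (hincr x y Hx Hy Hxy)) as [_ [_ H]]. }
  assert (Hreal : forall x, Icc a b x -> quot f1 f0 x = RtoK (phi x)).
  (* [Klt] makes both of its sides real, so comparing [x] with [b], or with [a] when x = b, shows
     that the quotient is real at [x]. *)
  { intros x Hx. apply RtoK_Kre. destruct (Rlt_dec x b) as [Hxb | Hxb].
    - now destruct (Klt_inv _ _ (hincr x b Hx Hb Hxb)) as [H _].
    - assert (Hax : a < x) by (destruct Hx; lra).
      now destruct (Klt_inv _ _ (hincr a x Ha Hx Hax)) as [_ [H _]]. }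
  assert (Hconcl : forall x l, Icc a b x -> real_derive a b phi x l -> 0 < l ->
    exists l : K, is_derive_on a b (quot f1 f0) x l /\ Klt zero l).
  { intros x l Hx Hl Hl0. exists (RtoK l). split.
    - now apply (is_derive_on_RtoK K a b hab phi).
    - exists 0, l. split; [symmetry; apply RtoK_zero | now split]. }
  assert (Hinterior : forall t B, is_gen_Bernstein_op a b (S N) U t B ->
    (forall k, (k < S N)%nat -> t k <= t (S k)) ->
    eq_on a b (B f0) f0 -> eq_on a b (B f1) f1 ->
    forall x, a < x < b -> exists l : K, is_derive_on a b (quot f1 f0) x l /\ Klt zero l).
  { intros t B HB Ht HB0 HB1 x Hx.
    destruct (fixed_quot_derive K a b hab N U f0 q hU hf0 hpos hq f1 t B hf1 HB HB0 HB1)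
      as [c [Hc Hder]].
    assert (HxI : Icc a b x) by (split; lra).
    apply (Hconcl x _ HxI (Hder x HxI)).
    eapply (derive_pos_interior a b hab N (fun j x => Kre (q j x))); try eassumption.
    - intros j Hj. apply Rmult_le_pos; [| now left; apply Hc].
      destruct HB as [p [alpha [_ [HtI _]]]].
      (* Coinciding nodes give coefficient 0 and distinct ones a positive coefficient. *)
      destruct (Ht j) as [Hlt | ->]; [lia | |].
      + apply Rlt_le, Rlt_0_minus. apply Hmono; [apply HtI; lia | apply HtI; lia | assumption].
      + fold (phi (t (S j))). lra.
    - intros j y. apply (D_basis_pos K a b N U f0 q hq).
    - now apply Hmono. }
  split; intros [t [B [HB [Ht [HB0 HB1]]]]] x Hx.
  - now apply (Hinterior t B).
  - destruct (fixed_quot_derive K a b hab N U f0 q hU hf0 hpos hq f1 t B hf1 HB HB0 HB1)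
      as [c [Hc Hder]].
    pose proof (D_basis_leading_term K a b hab N U f0 q hq) as HL.
    destruct (finite_choice 0 _ N (fun i Hi => proj1 (HL i Hi))) as [Ma HMa].
    destruct (finite_choice 0 _ N (fun i Hi => proj2 (HL i Hi))) as [Mb HMb].
    (* Strictly increasing nodes make every coefficient nonzero, in particular the first and the
       last, which decide the endpoints. *)
    assert (He : forall j, (j <= N)%nat -> (phi (t (S j)) - phi (t j)) * c j <> 0).
    { intros j Hj. apply Rgt_not_eq, Rmult_lt_0_compat; [| now apply Hc].
      destruct HB as [p [alpha [_ [HtI _]]]].
      apply Rlt_0_minus, Hmono; [apply HtI; lia | apply HtI; lia | apply Ht; lia]. }
    assert (Hmono' : forall x y, Icc a b x -> Icc a b y -> x < y -> phi x <= phi y).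
    { intros u v Hu Hv Huv. left. now apply Hmono. }
    destruct (Rlt_dec a x) as [Hax | Hax]; [destruct (Rlt_dec x b) as [Hxb | Hxb] |].
    + apply (Hinterior t B); auto. intros k Hk. now left; apply Ht.
    + replace x with b in * by (destruct Hx; lra).
      apply (Hconcl b _ Hb (Hder b Hb)).
      (* At [b] the order of [q i] is N - i, so [q N] is the one that survives. *)
      apply (derive_pos_endpoint a b hab N (fun j x => Kre (q j x)) (fun i => (N - i)%nat) _ Mb
        phi b N); [exact Hb | lia | exact (He N (le_n N)) | now apply HMb | lia | intros; lia |
        intros; now apply HMb | exact Hmono' | now apply Hder].
    + replace x with a in * by (destruct Hx; lra).
      apply (Hconcl a _ Ha (Hder a Ha)).
      (* At [a] the order of [q i] is i, so [q 0] is the one that survives. *)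
      apply (derive_pos_endpoint a b hab N (fun j x => Kre (q j x)) (fun i => i) _ Ma
        phi a 0); [exact Ha | lia | exact (He 0%nat (le_0_n N)) | apply HMa; lia | lia | intros; lia |
        intros; now apply HMa | exact Hmono' | now apply Hder].
Qed.
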